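(* Let $c>0$ be a constant, let $\gamma:\widehat{G}\to(0,\infty)$ be a measurable function, and let $\mathscr{L}_c$ be the map with domain $D(\mathscr{L}_c)=\mathfrak{H}^{\infty}_{c,\gamma}(G,H)$ and values in $S_2(H)$ defined by $\mathscr{L}_cT=-\mathcal{F}_U^{-1}\left[\left(1+\gamma(\cdot)^2e^{c\gamma(\cdot)^2}\right)\mathcal{F}_U(T)\right]$. If $S\in S_2(H)$, then the quantum generalized bosonic string equation $\mathscr{L}_cT=S$ has a unique solution $T_0$ in $D(\mathscr{L}_c)$, and $$\|T_0\|_{\mathfrak{H}^{\infty}_{c,\gamma}(G,H)}=\|S\|_{S_2(H)}.$$
   Context: Setting. $G$ is a locally compact abelian Hausdorff group with neutral element $e$ and Pontryagin dual $\widehat{G}$; $H$ is a separable complex Hilbert space. $U:G\to U(H)$, $x\mapsto U_x$, is a (strongly continuous) irreducible unitary projective representation of $G$ on $H$: $U_xU_y=m(x,y)U_{xy}$ for all $x,y\in G$, with multiplier $m:G\times G\to\mathbb{T}$ (the unit circle), and $U_e=I$. Put $\sigma(x,y)=m(x,y)/m(y,x)$, so that $U_xU_y=\sigma(x,y)U_yU_x$. It is assumed that: $m$ is a Heisenberg multiplier, i.e. $x\mapsto\sigma(x,\cdot)$ is a topological isomorphism from $G$ onto $\widehat{G}$; $m(x,y)=m(x^{-1},y^{-1})$ for all $x,y\in G$; $U$ is square integrable, i.e. there are non-zero $\phi,\psi\in H$ with $x\mapsto\langle U_x\phi,\psi\rangle$ in $L^2(G)$; and $U$ is integrable, i.e.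 there is a non-zero $\psi\in H$ with $x\mapsto\langle U_x\psi,\psi\rangle$ in $L^1(G)$. One identifies $\widehat{G}$ with $G$ through $\sigma$: for $\xi=\sigma(x,\cdot)\in\widehat{G}$ one writes $U_\xi:=U_x$. Schatten classes. For $1\le p<\infty$, $S_p(H)$ is the space of compact operators on $H$ whose singular values are $p$-summable, with norm $\|T\|_{S_p(H)}$ equal to the $\ell^p$ norm of the singular values. $S_1(H)$ is the trace class and $S_2(H)$ the Hilbert-Schmidt class. Quantum Fourier transform. For $T\in S_1(H)$, $\mathcal{F}_U(T)(\xi)=\mathrm{tr}(TU_\xi^* )$, $\xi\in\widehat{G}$. The Haar measure $d\xi$ on $\widehat{G}$ is normalized so that the (known) Plancherel theorem holds: $\mathcal{F}_U$ extends (uniquely) from $S_1(H)$ to a unitary operator $\mathcal{F}_U:S_2(H)\to L^2(\widehat{G})$. This extension defines $\mathcal{F}_U$ on $S_2(H)$, and $\mathcal{F}_U^{-1}:L^2(\widehat{G})\to S_2(H)$ denotes its inverse (equal to its adjoint). The domain space. $$\mathfrak{H}^{\infty}_{c,\gamma}(G,H)=\left\{T\in S_2(H) : \int_{\widehat{G}}\left(1+\gamma(\xi)^2e^{c\gamma(\xi)^2}\right)^2|\mathcal{F}_U(T)(\xi)|^2\,d\xi<\infty\right\},$$ $$\|T\|_{\mathfrak{H}^{\infty}_{c,\gamma}(G,H)}=\left(\int_{\widehat{G}}\left(1+\gamma(\xi)^2e^{c\gamma(\xi)^2}\right)^2|\mathcal{F}_U(T)(\xi)|^2\,d\xi\right)^{1/2}.$$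 *)

(* Defs.v *)
(* Conventions.  The group law of G is written additively (x + y, 0, - x for
   xy, e, x^-1).  Inner products are linear in the first argument.  Operators
   on H are plain functions H -> H together with linearity predicates, and
   elements of L^p are functions, compared up to almost-everywhere equality. *)
From HB Require Import structures.
From mathcomp Require Import all_boot all_order all_algebra sesquilinear complex.
From mathcomp Require Import all_classical all_reals all_analysis.
Set Implicit Arguments.
Unset Strict Implicit.
Unset Printing Implicit Defensive.
Import Order.TTheory GRing.Theory Num.Def Num.Theory.
Import numFieldNormedType.Exports.
Local Open Scope classical_set_scope.
Local Open Scope ring_scope.
Local Open Scope complex_scope.

(* C with the topology of its modulus; the cast is what lets the topological
   structures of numFieldType be found. *)
Notation Cplx R := ((R : rcfType)[i] : numFieldType).

(* The cast to zmodType selects 0 as the base point demanded by measurableType. *)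
Definition borel (T : PreTopologicalZmodule.type) :=
  @g_sigma_algebraType (T : zmodType) (@open T).

Record haar_measure (R : realType) (T : PreTopologicalZmodule.type)
    (mu : {measure set (borel T) -> \bar R}) : Prop := {
  haar_neq0 : mu setT <> 0%E ;
  haar_invariant : forall (x : T) (A : set (borel T)), measurable A ->
    mu [set x + y | y in (A : set T)] = mu A ;
  haar_compact_finite : forall K : set T, compact K -> (mu K < +oo)%E ;
  haar_outer_regular : forall A : set (borel T), measurable A ->
    mu A = ereal_inf [set mu V | V in [set V : set T | open V /\ A `<=` V]] ;
  haar_inner_regular : forall V : set T, open V ->
    mu V = ereal_sup [set mu K | K in [set K : set T | compact K /\ K `<=` V]] }.

Definition complex_measurable (R : realType) d (X : measurableType d)
    (f : X -> R[i]) : Prop :=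
  measurable_fun setT (fun x => complex.Re (f x)) /\
  measurable_fun setT (fun x => complex.Im (f x)).

Definition complex_Lnorm (R : realType) d (X : measurableType d)
    (mu : {measure set X -> \bar R}) (p : \bar R) (f : X -> R[i]) : \bar R :=
  Lnorm mu p (fun x => (ComplexField.Normc.normc (f x))%:E).

Definition complex_Lspace (R : realType) d (X : measurableType d)
    (mu : {measure set X -> \bar R}) (p : \bar R) : set (X -> R[i]) :=
  [set f | complex_measurable f /\ (complex_Lnorm mu p f < +oo)%E].

Section dual.
Variables (R : realType) (G : topologicalZmodType).

Definition is_character (chi : G -> Cplx R) : Prop :=
  [/\ continuous chi, forall x, `|chi x| = 1
    & forall x y, chi (x + y) = chi x * chi y].

Definition dual := {chi : G -> Cplx R | is_character chi}.

Definition dual_fun (xi : dual) : {compact-open, G -> Cplx R} := sval xi.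

Lemma dual_inj : injective dual_fun.
Proof. by move=> [f pf] [g pg] /= fg; exact: eq_exist. Qed.

HB.instance Definition _ := gen_eqMixin dual.
HB.instance Definition _ := gen_choiceMixin dual.

Lemma is_character1 : is_character (fun=> 1).
Proof.
by split=> [x|x|x y]; [exact: cvg_cst|rewrite normr1|rewrite mulr1].
Qed.

Lemma is_characterV chi : is_character chi -> is_character (fun x => (chi x)^-1).
Proof.
case=> cchi chi1 chiD; split=> [x|x|x y].
- apply: cvgV; last exact: cchi.
  by rewrite -normr_gt0 chi1 ltr01.
- by rewrite normfV chi1 invr1.
- by rewrite chiD invfM.
Qed.

Lemma is_characterM chi psi : is_character chi -> is_character psi ->
  is_character (fun x => chi x * psi x).
Proof.
move=> [cchi chi1 chiD] [cpsi psi1 psiD]; split=> [x|x|x y].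
- by apply: cvgM; [exact: cchi|exact: cpsi].
- by rewrite normrM chi1 psi1 mulr1.
- by rewrite chiD psiD mulrACA.
Qed.

Definition dual0 : dual := exist _ _ is_character1.
Definition dual_opp (xi : dual) : dual := exist _ _ (is_characterV (svalP xi)).
Definition dual_add (xi eta : dual) : dual :=
  exist _ _ (is_characterM (svalP xi) (svalP eta)).

Lemma dual_addA : associative dual_add.
Proof.
by move=> a b c; apply: dual_inj; apply/funext => x; exact: mulrA.
Qed.

Lemma dual_addC : commutative dual_add.
Proof.
by move=> a b; apply: dual_inj; apply/funext => x; exact: mulrC.
Qed.

Lemma dual_add0 : left_id dual0 dual_add.
Proof.
by move=> a; apply: dual_inj; apply/funext => x; exact: mul1r.
Qed.

Lemma dual_addN : left_inverse dual0 dual_opp dual_add.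
Proof.
move=> a; apply: dual_inj; apply/funext => x; apply: mulVf.
by have [_ a1 _] := svalP a; rewrite -normr_gt0 a1 ltr01.
Qed.

HB.instance Definition _ :=
  GRing.isZmodule.Build dual dual_addA dual_addC dual_add0 dual_addN.

HB.instance Definition _ := Topological.copy dual (initial_topology dual_fun).

End dual.

Section operators.
Variables (R : realType) (H : completeNormedModType R[i]).
Variable ip : {dot H for conjC}.

(* As H is complete, this makes H a Hilbert space. *)
Definition norm_of_inner_product : Prop := forall x : H, `|x| ^+ 2 = ip x x.

Definition separable : Prop := exists2 D : set H, countable D & dense D.

Definition unitary (V : H -> H) : Prop :=
  [/\ linear V, forall x y, ip (V x) (V y) = ip x y & set_surj setT setT V].

(* The adjoint of a bounded operator exists and is unique. *)
Definition adjoint (T : H -> H) : H -> H :=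
  get [set T' : H -> H | forall x y, ip (T x) y = ip x (T' y)].

Definition compact_operator (T : H -> H) : Prop :=
  linear T /\ precompact [set T x | x in ball (0 : H) 1].

Definition edim (A : set H) : \bar R :=
  ereal_sup [set n%:R%:E | n in [set n | exists v : 'I_n -> H,
    (forall i, A (v i)) /\
    (forall a : 'I_n -> R[i], \sum_i a i *: v i = 0 -> forall i, a i = 0)]].

(* The nonzero singular values of a compact T are the s > 0 such that s^2 is an
   eigenvalue of T^* T, repeated according to the multiplicity of s^2. *)
Definition singular_multiplicity (T : H -> H) (s : R) : \bar R :=
  edim [set x | adjoint T (T x) = (s ^+ 2)%:C *: x].

Definition schatten_norm (p : R) (T : H -> H) : \bar R :=
  ((\esum_(s in [set s : R | (0 < s)%R])
      (singular_multiplicity T s * (s `^ p)%:E)) `^ p^-1)%E.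

Definition schatten (p : R) : set (H -> H) :=
  [set T | compact_operator T /\ (schatten_norm p T < +oo)%E].

(* Orthonormal bases of the separable space H are enumerated by nat; unused
   indices (all but finitely many if H has finite dimension) carry 0. *)
Definition orthonormal_basis (e : nat -> H) : Prop :=
  [/\ forall i j, i <> j -> ip (e i) (e j) = 0,
      forall i, ip (e i) (e i) = 1 \/ e i = 0
    & forall x, (forall i, ip x (e i) = 0) -> x = 0].

Definition trace (T : H -> H) : R[i] :=
  get [set t : Cplx R | forall e, orthonormal_basis e ->
    series (fun n => ip (T (e n)) (e n) : Cplx R) @ \oo --> t].

End operators.

Section representation.
Variables (R : realType) (G : topologicalZmodType).
Variables (H : completeNormedModType R[i]) (ip : {dot H for conjC}).
Variables (U : G -> H -> H) (m : G -> G -> R[i]).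

Record projective_representation : Prop := {
  proj_unitary : forall x, unitary ip (U x) ;
  proj_continuous : forall phi, continuous (fun x => U x phi) ;
  proj_multiplier : forall x y, `|m x y| = 1 ;
  proj_mul : forall x y phi, U x (U y phi) = m x y *: U (x + y) phi ;
  proj_0 : U 0 = id }.

Definition irreducible_representation : Prop :=
  forall V : set H, closed V ->
    V 0 -> (forall (a : R[i]) phi psi, V phi -> V psi -> V (a *: phi + psi)) ->
    (forall x phi, V phi -> V (U x phi)) ->
    V = [set 0] \/ V = setT.

Definition sigma_form x y : R[i] := m x y / m y x.

Definition heisenberg_multiplier : Prop :=
  exists Phi : G -> dual R G,
    [/\ forall x y, dual_fun (Phi x) y = sigma_form x y,
        forall x y, Phi (x + y) = Phi x + Phi y,
        continuous Phi
      & exists Psi : dual R G -> G,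
          [/\ cancel Phi Psi, cancel Psi Phi & continuous Psi]].

Definition square_integrable_representation
    (lam : {measure set (borel G) -> \bar R}) : Prop :=
  exists phi psi : H, [/\ phi != 0, psi != 0 &
    complex_Lspace lam 2%:E (fun x => ip (U x phi) psi)].

Definition integrable_representation
    (lam : {measure set (borel G) -> \bar R}) : Prop :=
  exists2 psi : H, psi != 0 & complex_Lspace lam 1%:E (fun x => ip (U x psi) psi).

(* U_xi := U_x for the x such that xi = sigma(x, .). *)
Definition U_dual (xi : dual R G) : H -> H :=
  U (get [set x : (G : zmodType) | forall y, dual_fun xi y = sigma_form x y]).

Definition fourier_trace (T : H -> H) (xi : dual R G) : R[i] :=
  trace ip (T \o adjoint ip (U_dual xi)).

(* FU is the quantum Fourier transform on S_2(H): a unitary operator from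
   S_2(H) onto L^2 that extends fourier_trace.  This is also what normalizes mu. *)
Record quantum_fourier_transform (mu : {measure set (borel (dual R G)) -> \bar R})
    (FU : (H -> H) -> borel (dual R G) -> R[i]) : Prop := {
  qft_extends : forall T, schatten ip 1 T -> FU T = fourier_trace T %[ae mu] ;
  qft_L2 : forall T, schatten ip 2 T -> complex_Lspace mu 2%:E (FU T) ;
  qft_linear : forall (a : R[i]) T1 T2, schatten ip 2 T1 -> schatten ip 2 T2 ->
    FU (a \*: T1 \+ T2) = (fun xi => a * FU T1 xi + FU T2 xi) %[ae mu] ;
  qft_isometry : forall T, schatten ip 2 T ->
    complex_Lnorm mu 2%:E (FU T) = schatten_norm ip 2 T ;
  qft_injective : forall T1 T2, schatten ip 2 T1 -> schatten ip 2 T2 ->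
    FU T1 = FU T2 %[ae mu] -> T1 = T2 ;
  qft_surjective : forall g, complex_Lspace mu 2%:E g ->
    exists2 T, schatten ip 2 T & FU T = g %[ae mu] }.

End representation.

Section bosonic_string.
Variables (R : realType) (G : topologicalZmodType).
Variables (H : completeNormedModType R[i]) (ip : {dot H for conjC}).
Variable mu : {measure set (borel (dual R G)) -> \bar R}.
Variable FU : (H -> H) -> borel (dual R G) -> R[i].
Variables (c : R) (gamma : borel (dual R G) -> R).

Definition FU_inv (g : borel (dual R G) -> R[i]) : H -> H :=
  get [set T : H -> H | schatten ip 2 T /\ FU T = g %[ae mu]].

Definition weight xi : R := 1 + gamma xi ^+ 2 * expR (c * gamma xi ^+ 2).

Definition weighted_integral (T : H -> H) : \bar R :=
  (\int[mu]_xi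
     (weight xi ^+ 2 * ComplexField.Normc.normc (FU T xi) ^+ 2)%:E)%E.

Definition bosonic_domain : set (H -> H) :=
  [set T | schatten ip 2 T /\ (weighted_integral T < +oo)%E].

Definition bosonic_norm (T : H -> H) : \bar R :=
  (weighted_integral T `^ 2^-1)%E.

(* The value is meaningful only for T in bosonic_domain. *)
Definition bosonic_string (T : H -> H) : H -> H :=
  \- FU_inv (fun xi => (weight xi)%:C * FU T xi).

End bosonic_string.

(* Main.v *)
(* On the Fourier side L_c is multiplication by - w with w >= 1, so L_c T = S
   means w * FU T = FU (- S) almost everywhere.  As |w^-1| <= 1, the function
   w^-1 * FU (- S) is in L^2, hence is FU T0 for a unique T0, and the domain
   norm of T0 is the L^2 norm of w * FU T0 = FU (- S), which is the S_2 norm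
   of S. *)
Require Import Defs.
From HB Require Import structures.
From mathcomp Require Import all_boot all_order all_algebra sesquilinear complex.
From mathcomp Require Import all_classical all_reals all_analysis.
From mathcomp Require Import measurable_realfun.
Set Implicit Arguments.
Unset Strict Implicit.
Unset Printing Implicit Defensive.
Import Order.TTheory GRing.Theory Num.Def Num.Theory.
Import numFieldNormedType.Exports.
Local Open Scope classical_set_scope.
Local Open Scope ring_scope.

(** * Schatten classes and change of sign *)

Section schatten_opp.
Variables (R : realType) (H : completeNormedModType R[i]).
Variable ip : {dot H for conjC}.

Let ipNl x y : ip (- x) y = - ip x y.
Proof. exact: linearNl. Qed.

Let ipNr x y : ip x (- y) = - ip x y.
Proof. exact: linearNr. Qed.

Let ipBr x y z : ip x (y - z) = ip x y - ip x z.
Proof. exact: linearBr. Qed.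

(** The form is definite: at each [y], two candidates differ by a vector orthogonal to everything,
    itself included, so [get] has only one choice. *)
Lemma adjoint_unique (T T' : H -> H) :
  (forall x y, ip (T x) y = ip x (T' y)) -> adjoint ip T = T'.
Proof.
move=> TT'; apply: get_unique => // W TW; apply/funext => y.
by apply/eqP; rewrite -subr_eq0 -(dnorm_eq0 ip) ipBr -TW -TT' subrr.
Qed.

(* If T has no adjoint, then [adjoint] takes the same constant junk value at
   T and - T, so the equation holds unconditionally. *)
Lemma adjointN_comp (T : H -> H) (x : H) :
  adjoint ip (\- T) (- T x) = adjoint ip T (T x).
Proof.
have adjN (V W : H -> H) : (forall x y, ip (V x) y = ip x (W y)) ->
    forall x y, ip (- V x) y = ip x (- W y).
  by move=> VW u v; rewrite ipNl ipNr VW.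
have [[W TW]|noW] :=
    pselect (exists W : H -> H, forall x y, ip (T x) y = ip x (W y)).
  rewrite (adjoint_unique TW) (adjoint_unique (adjN _ _ TW)).
  (* Additivity of [W] is not at hand: the difference of the two sides is paired with itself and [W]
     is moved across the form as [T]. *)
  apply/eqP; rewrite -subr_eq0 -(dnorm_eq0 ip); apply/eqP.
  by rewrite ipBr ipNr -!TW ipNr opprK subrr.
rewrite /adjoint !getPN// => W.
- by move=> TW; apply: noW; exists W.
- move=> /adjN TW; apply: noW; exists (\- W) => u v.
  by rewrite -TW opprK.
Qed.

(** The singular values see [T] only through [adjoint ip T (T x)], which ignores the sign. *)
Lemma schatten_normN (p : R) (T : H -> H) :
  schatten_norm ip p (\- T) = schatten_norm ip p T.
Proof.
rewrite /schatten_norm; congr poweR; apply: eq_esum => s _.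
congr (edim _ * _)%E; apply/seteqP.
by split=> x /=; rewrite adjointN_comp.
Qed.

(** The unit ball is symmetric, so [T] and [\- T] map it onto the same set. This lets [S] carry the
    minus sign of the string operator. *)
Lemma schattenN (p : R) (T : H -> H) : schatten ip p T -> schatten ip p (\- T).
Proof.
move=> [[Tlin Tpre] Tfin]; split; last by rewrite schatten_normN.
split; first by move=> a x y /=; rewrite Tlin opprD scalerN.
suff -> : [set (\- T) x | x in ball (0 : H) 1] =
          [set T x | x in ball (0 : H) 1] by [].
have TN x : T (- x) = - T x.
  have T0 : T 0 = 0.
    by apply: (addrI (T 0)); have := Tlin 1 0 0; rewrite !scale1r !addr0.
  by have := Tlin (-1) x 0; rewrite !scaleN1r !addr0 T0 addr0.
by rewrite eqEsubset; split=> _ [x x1 <-]; exists (- x);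
  rewrite /= ?TN ?opprK//; move: x1; rewrite -ball_normE /= !sub0r !normrN.
Qed.

End schatten_opp.

(** * Square-integrable complex functions *)

Section complex_L2.
Variables (R : realType) (d : measure_display) (X : measurableType d).
Variable mu : {measure set X -> \bar R}.
Implicit Types (f g : X -> R[i]) (w : X -> R).
Local Notation normc := ComplexField.Normc.normc.
Local Open Scope complex_scope.

Lemma complex_Lnorm2E f :
  complex_Lnorm mu 2%:E f = ((\int[mu]_x (normc (f x) ^+ 2)%:E) `^ 2^-1)%E.
Proof.
rewrite /complex_Lnorm unlock; congr poweR; apply: eq_integral => x _.
by rewrite abse_EFin poweR_EFin powR_mulrn// real_normK// num_real.
Qed.

Lemma complex_Lspace2P f :
  complex_Lspace mu 2%:E f <->
  complex_measurable f /\ (\int[mu]_x (normc (f x) ^+ 2)%:E < +oo)%E.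
Proof.
rewrite /complex_Lspace /= complex_Lnorm2E; split=> -[mf fin]; split=> //.
  by apply: lty_poweRy fin; rewrite invr_neq0.
exact: poweR_lty.
Qed.

Lemma normc_real_mul (r : R) (z : R[i]) :
  normc (r%:C * z) ^+ 2 = r ^+ 2 * normc z ^+ 2.
Proof.
rewrite ComplexField.Normc.normcM exprMn /=; congr (_ * _).
by rewrite expr0n/= addr0 sqr_sqrtr// sqr_ge0.
Qed.

(** The squared modulus is a polynomial in the measurable real and imaginary parts. *)
Lemma measurable_normc2 f : complex_measurable f ->
  measurable_fun setT (fun x => (normc (f x) ^+ 2)%:E : \bar R).
Proof.
move=> [mre mim]; apply/measurable_EFinP.
rewrite (_ : (fun x => _) =
    (fun x => complex.Re (f x) ^+ 2 + complex.Im (f x) ^+ 2)).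
  by apply: measurable_funD; exact: measurable_funX.
apply/funext => x; case: (f x) => a b /=.
by rewrite sqr_sqrtr// addr_ge0 ?sqr_ge0.
Qed.

Lemma complex_measurable_scale w f : measurable_fun setT w ->
  complex_measurable f -> complex_measurable (fun x => (w x)%:C * f x).
Proof.
move=> mw [mre mim]; split.
- rewrite (_ : (fun x => _) = w \* (fun x => complex.Re (f x))).
    exact: measurable_funM.
  by apply/funext => x /=; case: (f x) => a b /=; rewrite mul0r subr0.
- rewrite (_ : (fun x => _) = w \* (fun x => complex.Im (f x))).
    exact: measurable_funM.
  by apply/funext => x /=; case: (f x) => a b /=; rewrite mul0r addr0.
Qed.

Lemma ae_eq_integral_normc2 f g : complex_measurable f -> complex_measurable g ->
  f = g %[ae mu] ->
  (\int[mu]_x (normc (f x) ^+ 2)%:E = \int[mu]_x (normc (g x) ^+ 2)%:E)%E.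
Proof.
move=> mf mg fg; apply: ge0_ae_eq_integral => //; try exact: measurable_normc2.
- by move=> x _; rewrite lee_fin sqr_ge0.
- by move=> x _; rewrite lee_fin sqr_ge0.
- by apply: filterS fg => x /= fgx _; rewrite fgx.
Qed.

End complex_L2.

(** * The string equation on the Fourier side *)

Section bosonic_equation.
Variables (R : realType) (G : topologicalZmodType).
Variables (H : completeNormedModType R[i]) (ip : {dot H for conjC}).
Variables (U : G -> H -> H) (m : G -> G -> R[i]).
Variable mu : {measure set (borel (dual R G)) -> \bar R}.
Variable FU : (H -> H) -> borel (dual R G) -> R[i].
Variables (c : R) (gamma : borel (dual R G) -> R).
Hypothesis qft : quantum_fourier_transform ip U m mu FU.
Hypothesis mgamma : measurable_fun setT gamma.
Local Notation normc := ComplexField.Normc.normc.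
Local Notation w := (weight c gamma).
Local Open Scope complex_scope.
Implicit Type T : H -> H.

Lemma weight_ge1 xi : 1 <= w xi.
Proof. by rewrite lerDl mulr_ge0 ?sqr_ge0 ?expR_ge0. Qed.

Lemma weight_gt0 xi : 0 < w xi.
Proof. exact: lt_le_trans (weight_ge1 xi). Qed.

Lemma measurable_weight : measurable_fun setT w.
Proof.
apply: measurable_funD => //; apply: measurable_funM.
  exact: measurable_funX.
apply: measurableT_comp => //; apply: measurable_funM => //.
exact: measurable_funX.
Qed.

Lemma measurable_weightV : measurable_fun setT (fun xi => (w xi)^-1).
Proof.
(* As [w xi > 0], its inverse is a composite of measurable functions. *)
rewrite (_ : (fun xi => _) = (fun xi => expR (- ln (w xi)))).
  apply: measurableT_comp => //; apply: measurableT_comp => //.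
  by apply: measurableT_comp => //; exact: measurable_weight.
by apply/funext => xi; rewrite expRN lnK// posrE weight_gt0.
Qed.

Lemma weighted_integralE T :
  weighted_integral mu FU c gamma T =
  (\int[mu]_xi (normc ((w xi)%:C * FU T xi) ^+ 2)%:E)%E.
Proof. by apply: eq_integral => xi _; rewrite normc_real_mul. Qed.

(** Ensures that on the domain [FU_inv] is applied to a genuine L^2 function. *)
Lemma weighted_L2 T : schatten ip 2 T ->
  (weighted_integral mu FU c gamma T < +oo)%E <->
  complex_Lspace mu 2%:E (fun xi => (w xi)%:C * FU T xi).
Proof.
move=> /(qft_L2 qft)[mT _]; rewrite complex_Lspace2P weighted_integralE.
split=> [fin|[]//]; split=> //.
by apply: complex_measurable_scale => //; exact: measurable_weight.
Qed.

(** Surjectivity of [FU] onto L^2 makes the set behind [get] nonempty, so the chosen value is a true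
    preimage. *)
Lemma FU_invP g : complex_Lspace mu 2%:E g ->
  schatten ip 2 (FU_inv ip mu FU g) /\ FU (FU_inv ip mu FU g) = g %[ae mu].
Proof.
move=> /(qft_surjective qft)[T T2 Tg].
exact: (@getI _ [set V : H -> H | schatten ip 2 V /\ FU V = g %[ae mu]] T).
Qed.

(** Reduces the operator equation to a multiplication equation: one direction applies [FU] to the
    chosen preimage, the other uses injectivity of [FU]. *)
Lemma bosonic_stringP S T : schatten ip 2 S ->
  bosonic_domain ip mu FU c gamma T ->
  bosonic_string ip mu FU c gamma T = S <->
  (fun xi => (w xi)%:C * FU T xi) = FU (\- S) %[ae mu].
Proof.
move=> S2 [T2 Tfin].
have [V2 VT] := FU_invP (proj1 (weighted_L2 T2) Tfin).
split=> [<-|TS].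
  (* With [S] replaced by the image of [T], the two signs cancel and [VT] applies. *)
  rewrite (_ : \- _ = FU_inv ip mu FU (fun xi => (w xi)%:C * FU T xi)).
    exact: ae_eq_sym.
  by apply/funext => x; rewrite /bosonic_string /= opprK.
have /(qft_injective qft) E := ae_eq_trans VT TS.
rewrite /bosonic_string E//; last exact: schattenN.
by apply/funext => x /=; rewrite opprK.
Qed.

(** The weight never vanishes, so it cancels pointwise and the two transforms agree almost
    everywhere. *)
Lemma bosonic_string_inj S T1 T2 : schatten ip 2 S ->
  bosonic_domain ip mu FU c gamma T1 -> bosonic_domain ip mu FU c gamma T2 ->
  bosonic_string ip mu FU c gamma T1 = S ->
  bosonic_string ip mu FU c gamma T2 = S -> T1 = T2.
Proof.
move=> S2 D1 D2 /(bosonic_stringP S2 D1) E1 /(bosonic_stringP S2 D2) E2.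
apply: (qft_injective qft); [exact: D1.1|exact: D2.1|].
apply: filterS2 E1 E2 => xi /= E1 E2 _.
have w0 : (w xi)%:C != 0 :> R[i].
  by rewrite (inj_eq (@complexI R)) gt_eqF// weight_gt0.
by apply: (mulfI w0); rewrite E1// E2.
Qed.

(** Both norms equal the L^2 norm of [FU (\- S)]: one by the equation, the other by the isometry. *)
Lemma bosonic_normE S T : schatten ip 2 S ->
  bosonic_domain ip mu FU c gamma T ->
  bosonic_string ip mu FU c gamma T = S ->
  bosonic_norm mu FU c gamma T = schatten_norm ip 2 S.
Proof.
move=> S2 DT /(bosonic_stringP S2 DT) E.
have [mT _] := qft_L2 qft DT.1.
have NS2 := schattenN S2; have [mS _] := qft_L2 qft NS2.
rewrite -schatten_normN -(qft_isometry qft NS2) complex_Lnorm2E.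
rewrite /bosonic_norm weighted_integralE; congr poweR.
apply: ae_eq_integral_normc2 => //.
by apply: complex_measurable_scale => //; exact: measurable_weight.
Qed.

Lemma bosonic_string_surj S : schatten ip 2 S ->
  exists2 T, bosonic_domain ip mu FU c gamma T &
             bosonic_string ip mu FU c gamma T = S.
Proof.
move=> S2; have NS2 := schattenN S2.
have /complex_Lspace2P[mS Sfin] := qft_L2 qft NS2.
(* The only possible transform of a solution, up to a null set. *)
pose g xi := ((w xi)^-1)%:C * FU (\- S) xi.
have mg : complex_measurable g.
  by apply: complex_measurable_scale => //; exact: measurable_weightV.
have /(qft_surjective qft)[T T2 Tg] : complex_Lspace mu 2%:E g.
  apply/complex_Lspace2P; split=> //; apply: le_lt_trans Sfin.
  apply: ge0_le_integral => //; try exact: measurable_normc2.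
  by move=> xi _; rewrite lee_fin sqr_ge0.
  (* Since [w xi >= 1], the modulus of [g] is at most that of [FU (\- S)]. *)
  move=> xi _; rewrite lee_fin normc_real_mul ler_piMl ?sqr_ge0//.
  have w0 := weight_gt0 xi.
  by rewrite expr_le1 ?invr_ge0 ?invf_le1 ?weight_ge1 ?ltW.
have TS : (fun xi => (w xi)%:C * FU T xi) = FU (\- S) %[ae mu].
  apply: filterS Tg => xi /= Tg xiT.
  rewrite Tg// /g mulrA -rmorphM/= mulfV ?gt_eqF ?weight_gt0//.
  by rewrite mul1r.
have [mT _] := qft_L2 qft T2.
(* By [TS] the weighted integral of [T] is the finite integral in [Sfin]. *)
have DT : bosonic_domain ip mu FU c gamma T.
  split=> //; rewrite weighted_integralE (ae_eq_integral_normc2 _ _ TS)//.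
  by apply: complex_measurable_scale => //; exact: measurable_weight.
by exists T => //; apply/(bosonic_stringP S2 DT).
Qed.

End bosonic_equation.

Theorem theorem4p2 (R : realType) (G : topologicalZmodType)
    (H : completeNormedModType R[i]) (ip : {dot H for conjC})
    (U : G -> H -> H) (m : G -> G -> R[i])
    (lam : {measure set (borel G) -> \bar R})
    (mu : {measure set (borel (dual R G)) -> \bar R})
    (FU : (H -> H) -> borel (dual R G) -> R[i])
    (c : R) (gamma : borel (dual R G) -> R) :
  hausdorff_space G -> locally_compact [set: G] ->
  norm_of_inner_product ip -> separable H ->
  projective_representation ip U m ->
  irreducible_representation U ->
  heisenberg_multiplier m ->
  (forall x y, m x y = m (- x) (- y)) ->
  haar_measure lam ->
  square_integrable_representation ip U lam ->
  integrable_representation ip U lam ->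
  haar_measure mu ->
  quantum_fourier_transform ip U m mu FU ->
  0 < c ->
  (forall xi, 0 < gamma xi) ->
  measurable_fun setT gamma ->
  forall S : H -> H, schatten ip 2 S ->
  exists T0 : H -> H,
    unique (fun T => bosonic_domain ip mu FU c gamma T /\
                     bosonic_string ip mu FU c gamma T = S) T0 /\
    bosonic_norm mu FU c gamma T0 = schatten_norm ip 2 S.
Proof.
move=> _ _ _ _ _ _ _ _ _ _ _ _ qft _ _ mgamma S S2.
have [T DT TS] := bosonic_string_surj c qft mgamma S2.
exists T; split; last exact: (bosonic_normE qft mgamma S2 DT TS).
split=> // T' [DT' T'S].
exact: (bosonic_string_inj qft mgamma S2 DT DT' TS T'S).
Qed.
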